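(* For every integer $k\geq 2$, \[ {\rm La}(n,\mathcal{O}_{4k})=(1+o(1))\binom{n}{\lfloor n/2\rfloor} \quad\text{and}\quad {\rm La}(n,\mathcal{O}_{4k-2})\leq\left(1+\frac{\sqrt2}{2}+o(1)\right)\binom{n}{\lfloor n/2\rfloor}, \] where $o(1)\to0$ as $n\to\infty$.
   Context: A poset $(S,\leq)$ contains a poset $(S',\leq')$ if there is an injection $f\colon S'\to S$ such that $u\leq' v$ implies $f(u)\leq f(v)$ (copies need not be induced). For a poset $H$, a family $\mathcal{F}\subseteq 2^{[n]}$ is $H$-free if $(\mathcal{F},\subseteq)$ does not contain $H$, and ${\rm La}(n,H)$ is the maximum size of an $H$-free family of subsets of $[n]$. For $m\geq 2$, the crown $\mathcal{O}_{2m}$ is the height-$2$ poset whose Hasse diagram is a cycle of length $2m$: it has minimal elements $a_1,\dots,a_m$ and maximal elements $b_1,\dots,b_m$ with $a_i<b_i$ and $a_{i+1}<b_i$ for all $i$ (indices mod $m$), and no other relations. *)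

(* Defs.v *)
From HB Require Import structures.
From mathcomp Require Import all_boot all_order.
From mathcomp Require Import boolp.

Set Implicit Arguments.
Unset Strict Implicit.
Unset Printing Implicit Defensive.

(* Copies need not be induced: f only has to preserve the order. *)
Definition poset_contains (d d' : Order.disp_t)
    (S : porderType d) (S' : porderType d') : Prop :=
  exists f : S' -> S,
    injective f /\ (forall u v : S', (u <= v)%O -> (f u <= f v)%O).

(* The ground set [n] is represented by 'I_n = {0, ..., n - 1}. *)
Definition family_poset (n : nat) (F : {set {set 'I_n}}) : Type :=
  {A : {set 'I_n} | A \in F}.

HB.instance Definition _ n (F : {set {set 'I_n}}) :=
  SubFinite.copy (family_poset F) {A : {set 'I_n} | A \in F}.

Definition family_le (n : nat) (F : {set {set 'I_n}}) (A B : family_poset F) :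
  bool := val A \subset val B.

Fact family_le_refl (n : nat) (F : {set {set 'I_n}}) :
  reflexive (@family_le n F).
Proof. by move=> A; apply: subxx. Qed.

Fact family_le_anti (n : nat) (F : {set {set 'I_n}}) :
  antisymmetric (@family_le n F).
Proof. by move=> A B AB; apply/val_inj/eqP; rewrite eqEsubset. Qed.

Fact family_le_trans (n : nat) (F : {set {set 'I_n}}) :
  transitive (@family_le n F).
Proof. by move=> B A C; apply: subset_trans. Qed.

Fact family_display : Order.disp_t. Proof. exact: Order.Disp tt tt. Qed.

HB.instance Definition _ n (F : {set {set 'I_n}}) :=
  Order.Le_isPOrder.Build family_display (family_poset F)
    (@family_le_refl n F) (@family_le_anti n F) (@family_le_trans n F).

Definition poset_free (d : Order.disp_t) (H : porderType d) (n : nat)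
    (F : {set {set 'I_n}}) : Prop :=
  ~ poset_contains (family_poset F) H.

Definition La (n : nat) (d : Order.disp_t) (H : porderType d) : nat :=
  \max_(F : {set {set 'I_n}} | `[< poset_free H F >]) #|F|.

(* crown m is the crown with 2m elements: inl i is the minimal element a_i and *)
(* inr i the maximal element b_i, and ordS i is i + 1 mod m.                   *)
Definition crown (m : nat) : Type := ('I_m + 'I_m)%type.

HB.instance Definition _ m := Finite.copy (crown m) ('I_m + 'I_m)%type.

Definition crown_le (m : nat) (x y : crown m) : bool :=
  match x, y with
  | inl i, inl j => i == j
  | inr i, inr j => i == j
  | inl i, inr j => (i == j) || (i == ordS j)
  | inr _, inl _ => false
  end.

Fact crown_le_refl (m : nat) : reflexive (@crown_le m).
Proof. by case=> i /=. Qed.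

Fact crown_le_anti (m : nat) : antisymmetric (@crown_le m).
Proof. by case=> i [] j //= /andP[] // /eqP->. Qed.

Fact crown_le_trans (m : nat) : transitive (@crown_le m).
Proof.
case=> j [] i [] k //=; first [by move=> /eqP-> | by move=> ij /eqP<-].
Qed.

Fact crown_display : Order.disp_t. Proof. exact: Order.Disp tt tt. Qed.

HB.instance Definition _ m := Order.Le_isPOrder.Build crown_display (crown m)
  (@crown_le_refl m) (@crown_le_anti m) (@crown_le_trans m).

(* Main.v *)
(** Take a uniformly random maximal chain and let [X] be the number of its
    members in the crown-free family [F]; then [#|F| <= E[X] * 'C(n, n %/ 2)].
    Sets outside a window of levels [[q, n - q]] are negligible.  A member of
    [F] with [m] members below it and [m] above it yields a crown, so chains
    with three members are rare and [E[X] <= 1 + s + o(1)], [s] being the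
    probability that [X >= 2].  Removing one or two early elements from such a
    chain, the Cauchy-Schwarz inequality shows that with probability at least
    [s ^ 2 - o(1)] two elements [x], [y] outside a random chain are joined:
    some members [T + x], [T' + y] of [F] lie below a member [T'' + x + y], where
    [T], [T'], [T''] belong to the chain.  An [m]-cycle of joined elements is
    a crown with [2m] elements, so [s ^ 2] is at most the edge density allowed
    by excluding an [m]-cycle: [o(1)] for even [m], [1 / 2 + o(1)] for odd
    [m]. *)

Require Import Defs.
From mathcomp Require Import all_boot all_order all_fingroup.
From mathcomp Require Import boolp zify.

Set Implicit Arguments.
Unset Strict Implicit.
Unset Printing Implicit Defensive.

(** * Cycles in dense graphs *)

Lemma exists_subset_card (T : finType) (A : {set T}) k : k <= #|A| ->
  exists2 B : {set T}, B \subset A & #|B| = k.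
Proof.
case/card_geqP => s [us ss sA]; exists [set x in s].
  by apply/subsetP => x; rewrite inE => /sA.
by rewrite cardsE -ss; apply/card_uniqP.
Qed.

Lemma cycle_nth (T : eqType) (e : rel T) (x0 : T) c (i : 'I_(size c)) :
  path.cycle e c -> e (nth x0 c i) (nth x0 c (ordS i)).
Proof.
case: c i => [[]//|x s] i /= /(pathP x0)/(_ i); rewrite size_rcons => /(_ (ltn_ord i)).
rewrite -rcons_cons nth_rcons ltn_ord nth_rcons.
have := ltn_ord i; rewrite {1}/size -/size ltnS leq_eqVlt => /orP[/eqP E|lt].
  by rewrite E ltnn eqxx modnn.
by rewrite lt modn_small.
Qed.

Section Graph.
Variables (V : finType) (e : rel V).
Hypotheses (symE : symmetric e) (irrE : irreflexive e).
Implicit Types (U S : {set V}) (p us : seq V).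

Definition nbhd U x : {set V} := [set y in U | e x y].

(** Counts ordered pairs: with [e] symmetric and irreflexive every edge contributes two. *)
Definition edges U := \sum_(x in U) #|nbhd U x|.

Lemma common_neighbour_avoiding U (A : {set V}) x y :
  #|A| < #|nbhd U x :&: nbhd U y| ->
  exists z, [/\ z \in U, e x z, e y z & z \notin A].
Proof.
move=> ltA; have /subsetPn[z] : ~~ (nbhd U x :&: nbhd U y \subset A).
  by apply/negP=> /subset_leq_card; rewrite leqNgt ltA.
by rewrite !inE => /andP[/andP[zU xz] /andP[_ yz]] zA; exists z.
Qed.

(** Greedy: consecutive vertices of [x :: us] are linked through fresh common neighbours. [A]
    collects the vertices to avoid and grows by one per link, as the bound on [#|A| + size us]
    permits. *)
Lemma zigzag_path U S K us x (A : {set V}) :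
  {in S &, forall a b, K <= #|nbhd U a :&: nbhd U b|} ->
  S \subset U -> {subset x :: us <= S} -> {subset x :: us <= A} ->
  uniq (x :: us) -> #|A| + size us <= K ->
  exists p, [/\ path e x p, last x p = last x us, size p = (size us).*2,
    uniq (x :: p) & forall z, z \in p -> z \in U /\ ((z \in us) || (z \notin A))].
Proof.
move=> common sSU; elim: us x A => [|y us IH] x A subS subA uni szA.
  by exists [::]; split.
have xS : x \in S by apply: subS; rewrite mem_head.
have yS : y \in S by apply: subS; rewrite !inE eqxx orbT.
have yA : y \in A by apply: subA; rewrite !inE eqxx orbT.
have xA : x \in A by apply: subA; rewrite mem_head.
have /common_neighbour_avoiding[z [zU xz yz zA]] :
    #|A| < #|nbhd U x :&: nbhd U y|.
  by apply: leq_trans (common _ _ xS yS); move: szA => /=; lia.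
have [||||p [pp lp sp up memp]] := IH y (z |: A).
- by move=> t tus; apply: subS; rewrite inE tus orbT.
- by move=> t tus; rewrite inE subA ?orbT// inE tus orbT.
- by case/andP: uni.
- by rewrite cardsU1 zA; move: szA => /=; lia.
have usA t : t \in us -> t \in A by move=> tus; apply: subA; rewrite !inE tus !orbT.
move: uni; rewrite /= inE negb_or -andbA => /and4P[xy xus yus uus].
exists (z :: y :: p); split => //=.
- by rewrite xz symE yz.
- by rewrite sp.
- move: up => /= /andP[-> ->]; rewrite !inE !negb_or xy !andbT.
  have zNx : z != x by apply: contraNneq zA => ->.
  have zNy : z != y by apply: contraNneq zA => ->.
  rewrite eq_sym zNx zNy /=; apply/andP; split.
    apply/negP => /memp[_ /orP[xus'|]]; first by rewrite xus' in xus.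
    by rewrite !inE xA orbT.
  apply/negP => /memp[_ /orP[/usA|]]; first by rewrite (negPf zA).
  by rewrite !inE eqxx.
- move=> t; rewrite !inE => /or3P[/eqP->|/eqP->|/memp[tU]].
  + by rewrite zU zA orbT.
  + by rewrite (subsetP sSU) // eqxx.
  + by rewrite !inE negb_or => /orP[->|/andP[_ ->]]; rewrite ?orbT.
Qed.

(** A zigzag from [x] to [y] through [r.-1] further vertices has [r.*2] edges; the edge between [x]
    and [y] closes it. *)
Lemma odd_cycle_of_common_neighbours U r :
  {in U &, forall a b, r.*2.+1 <= #|nbhd U a :&: nbhd U b|} ->
  0 < r -> (exists x y, [/\ x \in U, y \in U & e x y]) -> r < #|U| ->
  exists p, [/\ path.cycle e p, uniq p, size p = r.*2.+1 & {subset p <= U}].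
Proof.
move=> common r0 [x [y [xU yU xy]]] rU.
have xNy : x != y by apply: contraTneq xy => ->; rewrite irrE.
have : r.-1 <= #|U :\ x :\ y|.
  move: (cardsD1 x U) (cardsD1 y (U :\ x)); rewrite !inE xU yU eq_sym xNy /=.
  lia.
case/exists_subset_card => B BU cB.
have memB t : t \in B -> [/\ t != x, t != y & t \in U].
  by move=> /(subsetP BU); rewrite !inE => /and3P[].
have xB : x \notin B by apply/negP => /memB[]; rewrite eqxx.
have yB : y \notin B by apply/negP => /memB[]; rewrite eqxx.
set us := rcons (enum B) y.
have memus t : (t \in x :: us) = [|| t == x, t == y | t \in B].
  by rewrite !inE mem_rcons inE mem_enum.
have sus : size us = r by rewrite size_rcons -cardE cB prednK.
have uus : uniq (x :: us).
  by rewrite /= rcons_uniq mem_rcons inE !mem_enum enum_uniq yB negb_or xNy xB.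
have [||||p [pp lp sp up memp]] := @zigzag_path U U r.*2.+1 us x [set t in x :: us] common (subxx _).
- by move=> t; rewrite memus => /or3P[/eqP->|/eqP->|/memB[]].
- by move=> t tus; rewrite inE.
- by [].
- rewrite cardsE; move/card_uniqP: uus => ->; rewrite /= sus; lia.
exists (x :: p); split => //=.
- by rewrite rcons_path pp lp /us last_rcons symE.
- by rewrite sp sus.
- by move=> t; rewrite inE => /orP[/eqP->|/memp[]].
Qed.

(** A zigzag through [k] vertices of [S] has [2k - 1] vertices; a further common neighbour of its
    ends closes it. *)
Lemma even_cycle_of_common_neighbours U S k :
  {in S &, forall a b, 3 * k <= #|nbhd U a :&: nbhd U b|} ->
  0 < k -> S \subset U -> k <= #|S| ->
  exists p, [/\ path.cycle e p, uniq p, size p = k.*2 & {subset p <= U}].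
Proof.
move=> common k0 SU /exists_subset_card[B BS cB].
case E : (enum B) => [|x us].
  by move: k0; rewrite -cB cardE E.
have memB t : (t \in x :: us) = (t \in B) by rewrite -E mem_enum.
have sus : size us = k.-1 by move: cB; rewrite cardE E /= => <-.
have [||||p [pp lp sp up memp]] := @zigzag_path U S (3 * k) us x B common SU.
- by move=> t; rewrite memB => /(subsetP BS).
- by move=> t; rewrite memB.
- by rewrite -E enum_uniq.
- by rewrite cB sus; lia.
have xS : x \in S by apply: (subsetP BS); rewrite -memB mem_head.
have lS : last x p \in S by apply: (subsetP BS); rewrite lp -memB mem_last.
have /common_neighbour_avoiding[z [zU xz lz]] :
    #|[set t in x :: p]| < #|nbhd U x :&: nbhd U (last x p)|.
  rewrite cardsE; move/card_uniqP: (up) => ->; apply: leq_trans (common _ _ xS lS).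
  by rewrite /= sp sus; lia.
rewrite inE => zp.
exists (rcons (x :: p) z); split.
- by rewrite /= rcons_path last_rcons symE xz rcons_path pp lz.
- by rewrite rcons_uniq zp.
- by rewrite size_rcons /= sp sus; lia.
- move=> t; rewrite mem_rcons !inE => /or3P[/eqP->|/eqP->|/memp[]] //.
  by rewrite (subsetP SU).
Qed.

(** Pigeonhole: sort the vertices of [U] by their trace on a set [S] of [M] vertices of high degree.
    A trace with at least [k] elements shared by [3 * k] vertices gives the cycle. Otherwise few
    vertices have such large traces, and counting the edges between [S] and [U] contradicts the
    degrees. *)
Lemma dense_even_cycle U k D : 0 < k -> 0 < D ->
  3 * (2 * k * D) * 2 ^ (2 * k * D) + D * (2 * k * D) < #|U| ->
  2 * #|U| ^ 2 <= D * edges U ->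
  exists p, [/\ path.cycle e p, uniq p, size p = k.*2 & {subset p <= U}].
Proof.
(* Degrees of at least [w / D] on [S] make the average trace at least [M / D = 2k], twice the
   threshold [k]. *)
move=> k0 D0; set M := 2 * k * D => ltw dense; set w := #|U| in ltw dense.
pose H := [set v in U | w <= D * #|nbhd U v|].
have nbw v : #|nbhd U v| <= w.
  by apply: subset_leq_card; apply/subsetP => y; rewrite inE => /andP[].
have MH : M <= #|H|.
  rewrite leqNgt; apply/negP => ltH.
  have : D * edges U <= D * (#|H| * w) + w * w.
    rewrite /edges (bigID [in H]) /= mulnDr leq_add //.
      rewrite leq_mul2l -sum_nat_const; apply/orP; right.
      rewrite (eq_bigl [in H]); last by move=> v; rewrite !inE; case: (v \in U).
      by apply: leq_sum => v _; exact: nbw.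
    rewrite big_distrr /= -sum_nat_const.
    rewrite [X in _ <= X](bigID [in H]) /= -[leqLHS]add0n leq_add //.
    apply: leq_sum => v /andP[vU]; rewrite inE vU /= -ltnNge; exact: ltnW.
  have w0 : 0 < w by exact: leq_ltn_trans ltw.
  have ltDM : D * M < w by exact: leq_ltn_trans (leq_addl _ _) ltw.
  move: dense ltH; rewrite -mulnn.
  set E := edges U; move=> h1 h3 h4.
  have : D * (#|H| * w) <= D * M * w by rewrite mulnA leq_mul2r leq_mul2l (ltnW h3) !orbT.
  have : D * M * w < w * w by rewrite ltn_mul2r w0.
  lia.
case/exists_subset_card: MH => S SH cS.
have SU : S \subset U by apply: subset_trans SH _; apply/subsetP => v; rewrite inE => /andP[].
pose f z := [set v in S | e v z].
have [/existsP[J /and3P[JS kJ fJ]]|noJ] :=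
    boolP [exists J : {set V}, [&& J \subset S, k <= #|J| & 3 * k <= #|[set z in U | f z == J]|]].
  apply: (@even_cycle_of_common_neighbours U J k) => //; last exact: subset_trans SU.
  move=> a b aJ bJ; apply: leq_trans fJ _; apply: subset_leq_card.
  apply/subsetP => z; rewrite !inE => /andP[zU /eqP fz].
  by move: aJ bJ; rewrite -fz !inE zU => /andP[_ ->] /andP[_ ->].
have few (J : {set V}) : J \subset S -> k <= #|J| -> #|[set z in U | f z == J]| <= 3 * k.
  move=> JS kJ; rewrite leqNgt; apply: contra noJ => h; apply/existsP; exists J.
  by rewrite JS kJ ltnW.
exfalso.
have up : \sum_(z in U) #|f z| <= k * w + 2 ^ M * (3 * k * M).
  rewrite (bigID (fun z => #|f z| < k)) /= leq_add //.
    rewrite mulnC -sum_nat_const [leqRHS](bigID (fun z => #|f z| < k)) /=.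
    by rewrite -[leqLHS]addn0 leq_add // leq_sum // => z /andP[_ /ltnW].
  rewrite (partition_big f (fun J => (J \in powerset S) && (k <= #|J|))) /=; last first.
    move=> z /andP[_]; rewrite -leqNgt => ->; rewrite andbT powersetE.
    by apply/subsetP => v; rewrite inE => /andP[].
  rewrite -cS -card_powerset -sum_nat_const [leqRHS](bigID (fun J : {set V} => k <= #|J|)) /=.
  rewrite -[leqLHS]addn0 leq_add // leq_sum // => J /andP[]; rewrite powersetE => JS kJ.
  apply: leq_trans (leq_mul (few J JS kJ) (leqnn _)).
  rewrite -sum_nat_const.
  rewrite (eq_bigl [in [set z in U | f z == J]]).
    apply: leq_sum => z; rewrite inE => /andP[_ /eqP->]; exact: subset_leq_card.
  move=> z; rewrite !inE; have [->|] := eqVneq (f z) J; last by rewrite !andbF.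
  by rewrite -leqNgt kJ !andbT.
have low : M * w <= D * \sum_(z in U) #|f z|.
  have -> : \sum_(z in U) #|f z| = \sum_(v in S) #|nbhd U v|.
    transitivity (\sum_(z in U) \sum_(v in S) (e v z : nat)).
      apply: eq_bigr => z _; rewrite -sum1_card big_mkcond /=.
      rewrite [RHS]big_mkcond /=; apply: eq_bigr => v _; rewrite inE.
      by case: (v \in S); case: (e v z).
    rewrite exchange_big /=; apply: eq_bigr => v _.
    rewrite -sum1_card big_mkcond /= [RHS]big_mkcond /=.
    by apply: eq_bigr => z _; rewrite inE; case: (z \in U); case: (e v z).
  rewrite -cS -sum_nat_const big_distrr /=; apply: leq_sum => v /(subsetP SH).
  by rewrite inE => /andP[].
have : 2 * k * D * w <= D * (k * w + 2 ^ M * (3 * k * M)).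
  by apply: leq_trans low _; rewrite leq_mul2l up orbT.
have -> : 2 * k * D * w = D * k * (2 * w) by lia.
have -> : D * (k * w + 2 ^ M * (3 * k * M)) = D * k * (w + 3 * M * 2 ^ M) by lia.
by rewrite leq_pmul2l ?muln_gt0 ?D0 //; lia.
Qed.

Lemma edgesD1 U v : v \in U -> edges U = edges (U :\ v) + 2 * #|nbhd U v|.
Proof.
move=> vU; rewrite {1}/edges (bigD1 v) //= addnC mul2n -addnn addnA; congr (_ + _).
have -> : #|nbhd U v| = \sum_(x in U :\ v) (e x v : nat).
  rewrite -sum1_card big_mkcond /= [RHS]big_mkcond /=; apply: eq_bigr => x _.
  rewrite !inE symE; case: (x =P v) => [->|]; first by rewrite irrE andbF.
  by case: (x \in U); case: (e x v).
rewrite /edges -big_split /=; apply: eq_big => [x|x /andP[xU xv]].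
  by rewrite !inE andbC.
rewrite (cardsD1 v) inE vU /= addnC; congr (_ + _).
by apply: eq_card => y; rewrite !inE andbA.
Qed.

(** Delete vertices of low degree one at a time. A deletion lowers [d.*2 * edges U] by less than
    [2 * c * #|U|], which is exactly the drop of [c * (#|U| * #|U|.+1)], so the surplus [K]
    survives. *)
Lemma min_degree_subgraph c d U K :
  c * (#|U| * #|U|.+1) + K <= d.*2 * edges U -> 0 < K ->
  exists2 W : {set V}, W \subset U &
    (forall v, v \in W -> c * #|W| <= d.*2 * #|nbhd W v|) /\
    K <= d.*2 * edges W.
Proof.
move=> + K0; have [u] := ubnP #|U|; elim: u U => // u IH U ltu dense.
have [/forall_inP degU|] := boolP [forall v in U, c * #|U| <= d.*2 * #|nbhd U v|].
  by exists U => //; split=> //; lia.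
case/forall_inPn => v vU; rewrite -ltnNge => low.
have cU := cardsD1 v U; rewrite vU in cU.
have [||W WU prop] := IH (U :\ v).
- by lia.
- move: dense; rewrite (edgesD1 vU) cU.
  have -> : (true + #|U :\ v|) = #|U :\ v|.+1 by [].
  move: low; rewrite cU; nia.
by exists W => //; apply: subset_trans WU _; apply: subD1set.
Qed.

(** The density is [1 / 2 + 3 / D]. In a subgraph on [W] with degrees at least
    [(1 / 2 + 1 / D) * #|W|], any two vertices share at least [2 * #|W| / D] neighbours. *)
Lemma dense_odd_cycle U r D : 0 < r -> 0 < D ->
  2 * D * (D * r.*2.+1) + D + 2 < #|U| ->
  (D + 6) * #|U| ^ 2 <= D.*2 * edges U ->
  exists p, [/\ path.cycle e p, uniq p, size p = r.*2.+1 & {subset p <= U}].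
Proof.
move=> r0 D0 big dense.
(* The surplus gives [#|U| ^ 2 <= D.*2 * edges W], so [W] stays large and contains an edge. *)
have [||W WU [deg eW]] := @min_degree_subgraph (D + 2) D U (#|U| ^ 2).
- apply: leq_trans dense; rewrite -mulnn; nia.
- by rewrite expn_gt0; lia.
have cW v : #|nbhd W v| <= #|W|.
  by apply: subset_leq_card; apply/subsetP => y; rewrite inE => /andP[].
have W2 : edges W <= #|W| * #|W|.
  by rewrite -sum_nat_const; apply: leq_sum => v _; apply: cW.
have bigW : D * r.*2.+1 < #|W|.
  rewrite ltnNge; apply/negP => h.
  have : #|W| * #|W| <= (D * r.*2.+1) * (D * r.*2.+1) by apply: leq_mul.
  move: eW W2 big; rewrite -mulnn; set N := D * r.*2.+1; nia.
have [||||p [? ? ? pW]] := @odd_cycle_of_common_neighbours W r.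
- move=> a b aW bW; have := cardsUI (nbhd W a) (nbhd W b).
  have : #|nbhd W a :|: nbhd W b| <= #|W|.
    apply: subset_leq_card; apply/subsetP => y.
    by rewrite !inE => /orP[] /andP[].
  move: (deg a aW) (deg b bW) => da db h1 h2.
  have : D * #|W| + 2 * #|W| <= D * (#|nbhd W a| + #|nbhd W b|) by lia.
  rewrite -h2 mulnDr => h3.
  have h4 : D * #|nbhd W a :|: nbhd W b| <= D * #|W| by rewrite leq_mul2l h1 orbT.
  have h5 : D * r.*2.+1 <= D * #|nbhd W a :&: nbhd W b| by lia.
  by move: h5; rewrite leq_pmul2l.
- by [].
- have /existsP[x /existsP[y /and3P[*]]] :
      [exists x, exists y, [&& x \in W, y \in W & e x y]]; last by exists x, y.
  apply: contraTT eW => /existsPn noE; rewrite -ltnNge.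
  rewrite /edges big1 ?muln0 ?expn_gt0 => [|x xW]; first by lia.
  apply/eqP; rewrite cards_eq0; apply/eqP/setP => y; rewrite !inE.
  apply/negP => /andP[yW xy]; move: (noE x) => /existsPn/(_ y).
  by rewrite xW yW xy.
- by nia.
by exists p; split => // t /pW /(subsetP WU).
Qed.

End Graph.

(** * Random chains *)

Lemma crown_of_sets n m (F : {set {set 'I_n}}) (a b : 'I_m -> {set 'I_n}) :
  (forall i, a i \in F) -> (forall i, b i \in F) ->
  injective a -> injective b -> (forall i j, a i <> b j) ->
  (forall i, a i \subset b i) -> (forall i, a (ordS i) \subset b i) ->
  poset_contains (family_poset F) (crown m).
Proof.
move=> aF bF aI bI ab sab sSab.
pose f (x : crown m) : family_poset F :=
  match x with inl i => exist (fun A => A \in F) _ (aF i)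
             | inr i => exist (fun A => A \in F) _ (bF i) end.
exists f; split.
  move=> [i|i] [j|j] /(congr1 val) /= => [/aI->|/ab|/esym/ab|/bI->] //.
move=> [i|i] [j|j] //=.
- by move=> /eqP->; rewrite Order.POrderTheory.lexx.
- by rewrite /Order.le /= /crown_le /family_le /= => /orP[]/eqP->.
- by move=> /eqP->; rewrite Order.POrderTheory.lexx.
Qed.

(** Every member below [M] lies in every member above it, so any labelling satisfies the inclusions
    of the crown. *)
Lemma crown_of_below_above n m (F : {set {set 'I_n}}) (M : {set 'I_n}) :
  m <= #|[set A in F | A \proper M]| -> m <= #|[set B in F | M \proper B]| ->
  poset_contains (family_poset F) (crown m).
Proof.
set L := [set A in F | _]; set H := [set B in F | _] => mL mH.
pose a (i : 'I_m) := enum_val (widen_ord mL i).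
pose b (i : 'I_m) := enum_val (widen_ord mH i).
have aP i : (a i \in F) && (a i \proper M).
  by have := enum_valP (widen_ord mL i); rewrite inE.
have bP i : (b i \in F) && (M \proper b i).
  by have := enum_valP (widen_ord mH i); rewrite inE.
have ab i j : a i \proper b j.
  by apply: proper_trans (proj2 (andP (aP i))) (proj2 (andP (bP j))).
apply: (@crown_of_sets _ _ _ a b).
- by move=> i; case/andP: (aP i).
- by move=> i; case/andP: (bP i).
- by move=> i j /enum_val_inj/(congr1 val)/= /val_inj.
- by move=> i j /enum_val_inj/(congr1 val)/= /val_inj.
- by move=> i j E; have := ab i j; rewrite E properxx.
- by move=> i; apply: proper_sub.
- by move=> i; apply: proper_sub.
Qed.

Lemma sum_sqr_leq (T : finType) (f : T -> nat) :
  (\sum_t f t) ^ 2 <= #|T| * \sum_t f t ^ 2.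
Proof.
have -> : #|T| * \sum_t f t ^ 2 = \sum_(i : T) \sum_(t : T) f t ^ 2.
  by rewrite sum_nat_const.
rewrite -(leq_pmul2l (isT : 0 < 2)) -mulnn big_distrl /= big_distrr /=.
rewrite mul2n -addnn [X in X + _]exchange_big -big_split /=.
apply: leq_sum => i _; rewrite -big_split !big_distrr /=.
by apply: leq_sum => j _; apply: nat_Cauchy.
Qed.

(** Two transpositions suffice and move only [a], [b], [x], [y]. A set containing all four or none
    is thus preserved, which keeps the relevant chain members fixed when positions are exchanged. *)
Lemma two_transitive_perm (T : finType) (a b x y : T) : a != b -> x != y ->
  exists t : {perm T}, [/\ t a = x, t b = y &
    forall P : pred T, P b = P a -> P x = P a -> P y = P a ->
      forall i, P (t i) = P i].
Proof.
move=> ab xy; exists (tperm a x * tperm (tperm a x b) y)%g.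
have Nx : tperm a x b != x.
  by rewrite -{2}(tpermL a x) (inj_eq perm_inj) eq_sym.
split; first by rewrite permM tpermL tpermD // eq_sym.
  by rewrite permM tpermL.
move=> P Pb Px Py i; rewrite permM.
have P1 j : P (tperm a x j) = P j by case: tpermP => // ->.
rewrite -[RHS]P1; case: tpermP => // ->; rewrite ?P1 Py //.
Qed.

(** Colour each point by its membership in the two sets. By nestedness the sizes of the colour
    classes depend only on the two cardinals, so the two colourings are rearrangements of each
    other. *)
Lemma perm_of_nested_sets n (A M A' M' : {set 'I_n}) :
  A \subset M -> A' \subset M' -> #|A| = #|A'| -> #|M| = #|M'| ->
  exists t : 'S_n, forall i, ((t i \in A) = (i \in A')) /\ ((t i \in M) = (i \in M')).
Proof.
move=> sAM sAM' cA cM.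
pose col (B C : {set 'I_n}) i := (i \in B, i \in C).
have : perm_eq [tuple col A' M' i | i < n] [tuple col A M i | i < n].
  apply/allP => -[c1 c2] _; rewrite /= !count_map.
  have cnt (B C : {set 'I_n}) : B \subset C ->
      count (preim (col B C) (pred1 (c1, c2))) (enum 'I_n) =
      if c1 then if c2 then #|B| else 0 else if c2 then #|C| - #|B| else n - #|C|.
    move=> sBC; rewrite -size_filter.
    have -> : size [seq x <- enum 'I_n | preim (col B C) (pred1 (c1, c2)) x] =
        #|[set x | col B C x == (c1, c2)]|.
      by rewrite cardE enumT /enum_mem; congr size; apply: eq_filter => x; rewrite !inE.
    have nC : n - #|C| = #|~: C| by rewrite [RHS]cardsCs setCK card_ord.
    rewrite nC -cardsDS //.
    case: c1; case: c2.
    - apply: eq_card => x; rewrite !inE xpair_eqE !eqb_id.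
      by apply: andb_idr; apply: (subsetP sBC).
    - apply/eqP; rewrite cards_eq0; apply/eqP/setP => x; rewrite !inE xpair_eqE eqb_id eqbF_neg.
      by case xB: (x \in B) => //=; rewrite (subsetP sBC _ xB).
    - by apply: eq_card => x; rewrite !inE xpair_eqE eqb_id eqbF_neg andbC.
    - apply: eq_card => x; rewrite !inE xpair_eqE !eqbF_neg.
      by case xB: (x \in B) => //=; rewrite (subsetP sBC _ xB).
  by have := cnt _ _ sAM; rewrite cA cM -(cnt _ _ sAM') enumT => ->.
case/tuple_permP => t E; exists t => i.
have := congr1 (fun s => nth (false, false) s i) E.
have En (f : 'I_n -> bool * bool) : nth (false, false) [tuple f i | i < n] i = f i.
  by rewrite -tnth_nth tnth_mktuple.
by rewrite !En tnth_mktuple => -[-> ->].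
Qed.

Lemma leq_bin_self n k : 0 < k < n -> n <= 'C(n, k).
Proof.
elim: n k => [|n IH] [|k] //=; rewrite ltnS => kn; rewrite binS.
case: k kn => [|k] kn; first by rewrite bin1 bin0 addn1.
have [<-|ltk] := eqVneq k.+2 n; first by rewrite binn binSn.
have := IH k.+2; rewrite /= ltn_neqAle ltk kn => /(_ isT).
have : 0 < 'C(n, k.+1) by rewrite bin_gt0 ltnW.
lia.
Qed.

Lemma sum_eq_mem (T : finType) (S : {pred T}) (x : T) :
  \sum_(y in S) (x == y : nat) = (x \in S).
Proof.
rewrite big_mkcond (bigD1 x) //= big1 => [|y /negPf yx]; last first.
  by rewrite eq_sym yx; case: ifP.
by rewrite eqxx addn0; case: ifP.
Qed.

(* A permutation [p] sends elements to positions, so [p @^-1: init l] is the   *)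
(* [l]-th member of the maximal chain it encodes, and every other set built     *)
(* from that chain is the preimage of a set of positions.                       *)
Section Chains.
Variable n : nat.
Implicit Types (A B M Q : {set 'I_n}) (p r t : 'S_n).

Definition init (l : nat) : {set 'I_n} := [set i : 'I_n | i < l].

Lemma card_init l : #|init l| = minn l n.
Proof.
rewrite -sum1_card (eq_bigl (fun i : 'I_n => i < l)); last by move=> i; rewrite inE.
have [ln|/ltnW nl] := leqP l n.
  by rewrite -(big_ord_widen_cond n xpredT (fun=> 1)) // sum1_card card_ord.
rewrite (eq_bigl xpredT) ?sum1_card ?card_ord // => i.
by rewrite (leq_trans (ltn_ord i)).
Qed.

Lemma card_pull p Q : #|p @^-1: Q| = #|Q|.
Proof. by rewrite card_preimset //; apply: perm_inj. Qed.

Lemma pull_inj p : injective (fun Q => p @^-1: Q).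
Proof.
move=> Q Q' /setP E; apply/setP => x; have := E (p^-1 x)%g.
by rewrite !inE permKV.
Qed.

Lemma pullM p r Q : (p * r)%g @^-1: Q = p @^-1: (r @^-1: Q).
Proof. by apply/setP => x; rewrite !inE permM. Qed.

(** Right multiplication moves positions along the chain; left multiplication relabels the ground
    set. *)
Lemma sum_perm_mulr r (f : 'S_n -> nat) : \sum_p f p = \sum_p f (p * r)%g.
Proof. by rewrite (reindex_inj (mulIg r)). Qed.

Lemma sum_perm_mull r (f : 'S_n -> nat) : \sum_p f p = \sum_p f (r * p)%g.
Proof. by rewrite (reindex_inj (mulgI r)). Qed.

Lemma card_perm_ord : #|{: 'S_n}| = n`!.
Proof.
have := card_perm [set: 'I_n]; rewrite cardsT card_ord => <-.
by apply: eq_card => p; rewrite !inE; apply/esym/subsetP.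
Qed.

Definition hits A := \sum_(p : 'S_n) (p @^-1: init #|A| == A : nat).

Definition hits2 A M :=
  \sum_(p : 'S_n) ((p @^-1: init #|A| == A) && (p @^-1: init #|M| == M) : nat).

Lemma pull_init_eq p l A : l <= n -> p @^-1: init l == A -> #|A| = l.
Proof. by move=> ln /eqP <-; rewrite card_pull card_init (minn_idPl ln). Qed.

Lemma hits2_invariant A M A' M' :
  A \subset M -> A' \subset M' -> #|A| = #|A'| -> #|M| = #|M'| ->
  hits2 A M = hits2 A' M'.
Proof.
move=> sAM sAM' cA cM; have [t tP] := perm_of_nested_sets sAM sAM' cA cM.
rewrite /hits2 [RHS](sum_perm_mull t); apply: eq_bigr => p _.
have -> : A' = t @^-1: A by apply/setP => i; rewrite inE (tP i).1.
have -> : M' = t @^-1: M by apply/setP => i; rewrite inE (tP i).2.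
by rewrite !pullM !card_pull !(inj_eq (pull_inj (p:=t))).
Qed.

Lemma hits2_self A : hits2 A A = hits A.
Proof. by apply: eq_bigr => p _; rewrite andbb. Qed.

(** Each chain has exactly one member of size [#|A|], and by symmetry all sets of that size are met
    equally often. *)
Lemma hits_bin A : hits A * 'C(n, #|A|) = n`!.
Proof.
have -> : 'C(n, #|A|) = #|[set B : {set 'I_n} | #|B| == #|A|]|.
  by rewrite card_draws card_ord.
rewrite mulnC -sum_nat_const.
transitivity (\sum_(B in [set B : {set 'I_n} | #|B| == #|A|]) hits B).
  apply: eq_bigr => B; rewrite inE => /eqP cB.
  by rewrite -!hits2_self; apply: hits2_invariant.
rewrite exchange_big /= -card_perm_ord -[RHS]sum1_card; apply: eq_big => // p _.
rewrite (eq_bigr (fun B => (p @^-1: init #|A| == B) : nat)); last first.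
  by move=> B; rewrite inE => /eqP->.
rewrite sum_eq_mem inE card_pull card_init (minn_idPl _) ?eqxx //.
by rewrite -[leqRHS]card_ord max_card.
Qed.

(** Chains through [M] are spread evenly over the subsets of [M] of the size of [A]; as [A] is
    neither empty nor [M], there are at least [#|M|] of these. *)
Lemma hits2_below A M : A \proper M -> A != set0 -> #|M| * hits2 A M <= hits M.
Proof.
move=> AM A0.
apply: (@leq_trans ('C(#|M|, #|A|) * hits2 A M)).
  by rewrite leq_mul2r leq_bin_self ?orbT // card_gt0 A0 proper_card.
rewrite -cards_draws -sum_nat_const.
rewrite (eq_bigr (fun B => hits2 B M)); last first.
  move=> B; rewrite inE => /andP[BM /eqP cB].
  by apply: hits2_invariant; rewrite // proper_sub.
rewrite exchange_big /=; apply: leq_sum => p _.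
case: (_ == M); last by rewrite big1 // => B _; rewrite andbF.
under eq_bigr => B do rewrite andbT.
rewrite (eq_bigr (fun B => (p @^-1: init #|A| == B) : nat)); last first.
  by move=> B; rewrite inE => /andP[_ /eqP->].
by rewrite sum_eq_mem leq_b1.
Qed.

Lemma hits2_above M B : M \proper B -> B != setT -> (n - #|M|) * hits2 M B <= hits M.
Proof.
move=> MB BT; pose S := [set B' : {set 'I_n} | (M \subset B') && (#|B'| == #|B|)].
have sMB := proper_sub MB.
have cB : #|B| < n.
  rewrite -[ltnRHS]card_ord -cardsT; apply: proper_card.
  by rewrite properEneq BT subsetT.
(* The supersets of [M] of the size of [B] arise by adding to [M] a subset of its complement,
   neither empty nor full. *)
have cS : n - #|M| <= #|S|.
  have cM : #|~: M| = n - #|M| by rewrite [LHS]cardsCs setCK card_ord.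
  rewrite -cM; apply: (@leq_trans 'C(#|~: M|, #|B| - #|M|)).
    apply: leq_bin_self; have := proper_card MB; rewrite cM; lia.
  rewrite -cards_draws -(card_in_imset (f := fun C => M :|: C)); last first.
    move=> C D; rewrite !inE => /andP[CM _] /andP[DM _] /setP E.
    apply/setP => x; have := E x; rewrite !inE.
    have [xM|] //= := boolP (x \in M).
    have notin (K : {set 'I_n}) : K \subset ~: M -> (x \in K) = false.
      by move=> KM; apply/negP => /(subsetP KM); rewrite inE xM.
    by rewrite !notin.
  apply: subset_leq_card; apply/subsetP => _ /imsetP[C + ->].
  rewrite !inE subsetUl /= => /andP[CM /eqP cC].
  rewrite cardsU cC (_ : M :&: C = set0) ?cards0 ?subn0.
    by apply/eqP; rewrite subnKC // subset_leq_card.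
  apply/setP => x; rewrite !inE; apply/negP => /andP[xM /(subsetP CM)].
  by rewrite inE xM.
apply: (@leq_trans (#|S| * hits2 M B)); first by rewrite leq_mul2r cS orbT.
rewrite -sum_nat_const.
rewrite (eq_bigr (fun B' => hits2 M B')); last first.
  move=> B'; rewrite inE => /andP[BM' /eqP cB'].
  by apply: hits2_invariant.
rewrite exchange_big /=; apply: leq_sum => p _.
case: (_ == M); last by rewrite big1.
rewrite (eq_bigr (fun B' => (p @^-1: init #|B| == B') : nat)); last first.
  by move=> B'; rewrite inE => /andP[_ /eqP->].
by rewrite sum_eq_mem leq_b1.
Qed.

End Chains.

Lemma sum_bool_card (T : finType) (P : pred T) :
  \sum_x (P x : nat) = #|[set x | P x]|.
Proof. by rewrite -sum1dep_card [RHS]big_mkcond; apply: eq_bigr => x _; case: (P x). Qed.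

Lemma leq_bin_half n k : 'C(n, k) <= 'C(n, n %/ 2).
Proof.
have up j : j <= n %/ 2 -> 'C(n, j) <= 'C(n, n %/ 2).
  move=> jn; rewrite -(subKn jn); move: (n %/ 2 - j) (leq_subr j (n %/ 2)).
  elim=> [|i IH] ilt; first by rewrite subn0.
  apply: leq_trans (IH (ltnW ilt)); set h := n %/ 2 - i.+1.
  have -> : n %/ 2 - i = h.+1 by lia.
  have := mul_bin_left n h; have : h.+1 <= n - h by lia.
  set a := 'C(n, h); set b := 'C(n, h.+1); nia.
have [kn|kn] := leqP k n; last by rewrite bin_small.
have [|lt] := leqP k (n %/ 2); first exact: up.
by rewrite -bin_sub //; apply: up; lia.
Qed.

(** * Members of a family on a random chain *)

Section Family.
Variables (n m q : nat) (F : {set {set 'I_n.+1}}).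
Hypothesis F_window : forall A, A \in F -> q <= #|A| <= n.+1 - q.
Hypothesis q_gt1 : 1 < q.
Hypothesis q_small : q <= n.+1.
Implicit Types (A B M Q : {set 'I_n.+1}) (p r t : 'S_n.+1).

(** [init _ l] is the full set for all [l >= n.+1]; the window rules out these levels. *)
Lemma init_window p Q l : p @^-1: Q \in F -> init n.+1 l \subset Q -> l <= n.+1 - q.
Proof.
move=> /F_window/andP[_]; rewrite card_pull => cQ /subset_leq_card.
by rewrite card_init; lia.
Qed.

Lemma window_init p Q l : p @^-1: Q \in F -> Q \subset init n.+1 l -> q <= l.
Proof.
move=> /F_window/andP[+ _]; rewrite card_pull => cQ /subset_leq_card.
by rewrite card_init; lia.
Qed.

Definition chain_count p := \sum_(l < n.+2) (p @^-1: init _ l \in F : nat).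

Definition two_on_chain p : Prop :=
  exists l g, [/\ l < g, p @^-1: init _ l \in F & p @^-1: init _ g \in F].

Definition interior_level p (l : nat) : Prop :=
  (exists2 k, k < l & p @^-1: init _ k \in F) /\
  (exists2 k, l < k & p @^-1: init _ k \in F).

(** The lowest member accounts for [1], the highest, if different, for [two_on_chain]; all others
    are interior. *)
Lemma chain_count_le p :
  chain_count p <= 1 + `[< two_on_chain p >] +
    \sum_(l < n.+2) ((p @^-1: init _ l \in F) && `[< interior_level p l >] : nat).
Proof.
rewrite /chain_count !sum_bool_card; set L := [set l | _]; set I := [set l | _ && _].
have [->|[l0 l0L]] := set_0Vmem L; first by rewrite cards0.
case: (arg_minnP (fun l : 'I_n.+2 => l : nat) l0L) => lo loL lomin.
case: (arg_maxnP (fun l : 'I_n.+2 => l : nat) l0L) => hi hiL himax.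
have {}himax j : j \in L -> j <= hi by move=> jL; apply: himax.
have loF : p @^-1: init _ lo \in F by have : lo \in L := loL; rewrite inE.
have hiF : p @^-1: init _ hi \in F by have : hi \in L := hiL; rewrite inE.
have LI : L \subset [set lo; hi] :|: I.
  apply/subsetP => l lL; rewrite !inE.
  have [//|llo] := eqVneq l lo; have [//|lhi] := eqVneq l hi.
  move: (lL); rewrite inE => -> /=; apply/asboolP; split.
    exists lo => //.
    by rewrite ltn_neqAle eq_sym llo lomin.
  exists hi => //.
  by rewrite ltn_neqAle lhi himax.
apply: leq_trans (subset_leq_card LI) _.
apply: leq_trans (leq_card_setU _ _) _; rewrite leq_add2r cards2 add1n ltnS.
have [//|lohi] := eqVneq lo hi; rewrite lt0b; apply/asboolP; exists lo, hi; split=> //.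
by rewrite ltn_neqAle lohi himax.
Qed.

Lemma sum_chain_members (P : pred nat) p :
  \sum_(l < n.+2) ((p @^-1: init _ l \in F) && P l : nat) =
  \sum_(A in F) ((p @^-1: init _ #|A| == A) && P #|A| : nat).
Proof.
transitivity (\sum_(l < n.+2) \sum_(A in F) ((p @^-1: init _ l == A) && P l : nat)).
  apply: eq_bigr => l _; case: (P l); last by rewrite andbF big1 // => A; rewrite andbF.
  rewrite andbT -sum_eq_mem; apply: eq_bigr => A _; by rewrite andbT.
rewrite exchange_big /=; apply: eq_bigr => A _.
have cA : #|A| < n.+2 by rewrite ltnS -[leqRHS]card_ord max_card.
rewrite (bigD1 (Ordinal cA)) //= big1 ?addn0 // => l lA.
case E : (_ == A) => //=; case/eqP: lA; apply: val_inj => /=.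
by rewrite (pull_init_eq _ E) // -ltnS.
Qed.

Lemma sum_chain_count : \sum_(p : 'S_n.+1) chain_count p = \sum_(A in F) hits A.
Proof.
rewrite [RHS]exchange_big /=; apply: eq_bigr => p _.
transitivity (\sum_(A in F) ((p @^-1: init _ #|A| == A) && true : nat)).
  rewrite -(sum_chain_members (fun=> true)).
  by apply: eq_bigr => l _; rewrite andbT.
by apply: eq_bigr => A _; rewrite andbT.
Qed.

(** The LYM argument: by [hits_bin], a random chain meets [A] with probability
    [1 / 'C(n.+1, #|A|)]. *)
Lemma lubell : #|F| * (n.+1)`! <= 'C(n.+1, n.+1 %/ 2) * \sum_(p : 'S_n.+1) chain_count p.
Proof.
rewrite sum_chain_count -sum_nat_const big_distrr /=; apply: leq_sum => A _.
by rewrite -(hits_bin A) mulnC leq_mul2r leq_bin_half orbT.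
Qed.

Lemma pull_init_proper p k l : p @^-1: init _ k \in F -> p @^-1: init _ l \in F ->
  k < l -> p @^-1: init _ k \proper p @^-1: init _ l.
Proof.
move=> kF lF kl; rewrite properEcard !card_pull !card_init; apply/andP; split.
  by apply: preimsetS; apply/subsetP => i; rewrite !inE => /ltn_trans->.
by have := init_window kF (subxx _); have := init_window lF (subxx _); lia.
Qed.

(** By crown-freeness a member [M] has fewer than [m] members below it or fewer than [m] above it. A
    chain on which [M] is interior meets one of them, and each lies on at most a fraction [1 / q] of
    the chains through [M]. *)
Lemma sum_interior_le : poset_free (crown m) F ->
  q * \sum_(p : 'S_n.+1) \sum_(l < n.+2) ((p @^-1: init _ l \in F) && `[< interior_level p l >] : nat)
  <= m * \sum_(p : 'S_n.+1) chain_count p.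
Proof.
move=> free; rewrite sum_chain_count.
rewrite [X in q * X](eq_bigr (fun p : 'S_n.+1 => \sum_(A in F)
    ((p @^-1: init _ #|A| == A) && `[< interior_level p #|A| >] : nat))); last first.
  by move=> p _; apply: (sum_chain_members (fun l => `[< interior_level p l >])).
rewrite exchange_big /= !big_distrr /=; apply: leq_sum => M MF.
have /andP[qM Mq] := F_window MF.
have bound (S : {set {set 'I_n.+1}}) (h : {set 'I_n.+1} -> nat) :
    #|S| < m -> (forall A, A \in S -> q * h A <= hits M) ->
    \sum_(p : 'S_n.+1) ((p @^-1: init _ #|M| == M) && `[< interior_level p #|M| >] : nat) <= \sum_(A in S) h A ->
    q * \sum_(p : 'S_n.+1) ((p @^-1: init _ #|M| == M) && `[< interior_level p #|M| >] : nat) <= m * hits M.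
  move=> Sm hS le; apply: (@leq_trans (q * \sum_(A in S) h A)).
    by rewrite leq_mul2l le orbT.
  apply: (@leq_trans (#|S| * hits M)); last by rewrite leq_mul2r ltnW ?orbT.
  by rewrite big_distrr -sum_nat_const /=; apply: leq_sum.
have [few|many] := ltnP #|[set A in F | A \proper M]| m.
  apply: (bound _ (fun A => hits2 A M) few) => [A|].
    rewrite inE => /andP[AF AM]; have /andP[qA _] := F_window AF.
    apply: leq_trans (hits2_below AM _); first by rewrite leq_mul2r qM orbT.
    by rewrite -card_gt0; lia.
  rewrite exchange_big /=; apply: leq_sum => p _.
  case: eqP => //= EM; case: asboolP => // -[[k kM kF] _].
  have kl : k <= n.+1 by have := init_window kF (subxx _); lia.
  rewrite -EM in MF.
  rewrite (bigD1 (p @^-1: init _ k)) /=; last first.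
    by rewrite inE kF; have := pull_init_proper kF MF kM; rewrite EM.
  by rewrite card_pull card_init (minn_idPl kl) eqxx.
have [few|many'] := ltnP #|[set B in F | M \proper B]| m.
  apply: (bound _ (fun B => hits2 M B) few) => [B|].
    rewrite inE => /andP[BF MB]; have /andP[_ qB] := F_window BF.
    apply: leq_trans (hits2_above MB _); first by rewrite leq_mul2r; apply/orP; right; lia.
    apply: contraTneq qB => ->; rewrite cardsT card_ord; lia.
  rewrite exchange_big /=; apply: leq_sum => p _.
  case: eqP => //= EM; case: asboolP => // -[_ [k kM kF]].
  have kl : k <= n.+1 by have := init_window kF (subxx _); lia.
  rewrite -EM in MF.
  rewrite (bigD1 (p @^-1: init _ k)) /=; last first.
    by rewrite inE kF; have := pull_init_proper MF kF kM; rewrite EM.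
  by rewrite card_pull card_init (minn_idPl kl) eqxx.
by case: free; apply: crown_of_below_above many many'.
Qed.

(** Used for [x < q]: the chain members involved have level at least [q], so the element at position
    [x] is really removed, and these positions are exchangeable. *)
Definition pred_below p (x : 'I_n.+1) : Prop :=
  exists l g, [/\ l <= g, p @^-1: (init _ l :\ x) \in F & p @^-1: init _ g \in F].

Lemma lift_perm0E (l i : 'I_n.+1) :
  lift_perm ord0 l 1 i = (if i == ord0 then l : nat else if i <= l then i.-1 else i) :> nat.
Proof.
case: (unliftP ord0 i) => [j ->|->]; last by rewrite lift_perm_id eqxx.
rewrite lift_perm_lift perm1 eq_sym (negPf (neq_lift _ _)) /= /bump /=.
by case: (leqP l j); lia.
Qed.

Lemma pull_lift_perm0_low (l : 'I_n.+1) k : k <= l ->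
  lift_perm ord0 l 1 @^-1: init _ k = init _ k.+1 :\ ord0.
Proof.
move=> kl; apply/setP => i; rewrite !inE lift_perm0E -!val_eqE /=.
by case: eqP => [->|i0] /=; [|case: (leqP i l)]; lia.
Qed.

Lemma pull_lift_perm0_high (l : 'I_n.+1) k : l < k ->
  lift_perm ord0 l 1 @^-1: init _ k = init _ k.
Proof.
move=> lk; apply/setP => i; rewrite !inE lift_perm0E -!val_eqE /=.
by case: eqP => [->|i0] /=; [|case: (leqP i l)]; lia.
Qed.

(* Split according to the first member of [F] on the chain, at level [l], and  *)
(* move the element added right after it to position 0.                         *)
Lemma sum_two_on_chain_le :
  \sum_(p : 'S_n.+1) (`[< two_on_chain p >] : nat) <= \sum_(p : 'S_n.+1) (`[< pred_below p ord0 >] : nat).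
Proof.
pose first p (l : nat) := [/\ p @^-1: init _ l \in F,
  forall k, k < l -> p @^-1: init _ k \notin F &
  exists2 g, l < g & p @^-1: init _ g \in F].
pose first' p (l : nat) := [/\ p @^-1: (init _ l.+1 :\ ord0) \in F,
  forall k, k < l -> p @^-1: (init _ k.+1 :\ ord0) \notin F &
  exists2 g, l < g & p @^-1: init _ g \in F].
apply: (@leq_trans (\sum_(p : 'S_n.+1) \sum_(l < n.+1) (`[< first p l >] : nat))).
  apply: leq_sum => p _; case: asboolP => // -[l [g [lg lF gF]]].
  have exl : exists l, p @^-1: init _ l \in F by exists l.
  case: (ex_minnP exl) => l0 l0F l0min.
  have l0n : l0 < n.+1 by have := init_window l0F (subxx _); lia.
  rewrite (bigD1 (Ordinal l0n)) //=; case: asboolP => //; case; split=> //.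
    by move=> k kl; apply/negP => /l0min; lia.
  by exists g => //; apply: leq_ltn_trans lg; apply: l0min.
rewrite exchange_big /=.
apply: (@leq_trans (\sum_(p : 'S_n.+1) \sum_(l < n.+1) (`[< first' p l >] : nat))).
  rewrite [leqRHS]exchange_big /=; apply: leq_sum => l _.
  rewrite (sum_perm_mulr (lift_perm ord0 l 1)); apply: leq_sum => p _.
  case: asboolP => // -[h1 h2 [g lg gF]]; case: asboolP => // -[]; split.
  - by rewrite -(@pull_lift_perm0_low l) // -pullM.
  - by move=> k kl; rewrite -(@pull_lift_perm0_low l) ?(ltnW kl) // -pullM h2.
  - by exists g => //; move: gF; rewrite pullM pull_lift_perm0_high.
apply: leq_sum => p _; case: asboolP => [_|nG]; last first.
  rewrite big1 // => l _; case: asboolP => // -[h1 _ [g lg gF]].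
  by case: nG; exists l.+1, g.
(* [first' p l] forbids every earlier level, so at most one [l] contributes. *)
have [l0 /asboolP[h1 h2 _]|none] := pickP (fun l : 'I_n.+1 => `[< first' p l >]); last first.
  by rewrite big1 // => l _; rewrite none.
rewrite (bigD1 l0) //= [X in _ + X]big1 ?addn0 ?leq_b1 // => l ll0.
case: asboolP => // -[h1' h2' _]; case/eqP: ll0; apply: val_inj => /=.
by case: (ltngtP l l0) => // [/h2|/h2']; rewrite ?h1 ?h1'.
Qed.

Lemma pred_below_perm p t (a x : 'I_n.+1) : t a = x ->
  (forall l, q <= l -> forall i, (t i < l) = (i < l)) ->
  `[< pred_below (p * t)%g x >] = `[< pred_below p a >].
Proof.
move=> tax tl.
have E l : q <= l -> (p * t)%g @^-1: (init _ l :\ x) = p @^-1: (init _ l :\ a).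
  move=> ql; rewrite pullM (_ : t @^-1: _ = init _ l :\ a) //; apply/setP => i.
  by rewrite !inE -tax (inj_eq perm_inj) tl.
have E' l : q <= l -> (p * t)%g @^-1: init _ l = p @^-1: init _ l.
  by move=> ql; rewrite pullM; apply/setP => i; rewrite !inE tl.
apply: asbool_equiv_eq; split=> -[l [g [lg h1 h2]]]; exists l, g;
  have ql := window_init h1 (subD1set _ _); have qg := leq_trans ql lg.
  by rewrite -E // -E'.
by rewrite E // E'.
Qed.

Lemma sum_pred_below (x : 'I_n.+1) : x < q ->
  \sum_(p : 'S_n.+1) (`[< pred_below p x >] : nat) =
  \sum_(p : 'S_n.+1) (`[< pred_below p ord0 >] : nat).
Proof.
move=> xq; rewrite (sum_perm_mulr (tperm ord0 x)); apply: eq_bigr => p _.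
rewrite (@pred_below_perm _ _ ord0) ?tpermL // => l ql i.
have q0 : ord0 < l by rewrite /=; lia.
by case: tpermP => // ->; rewrite q0 (leq_trans xq ql).
Qed.

Lemma sum_pred_below2 (a b x y : 'I_n.+1) :
  a < q -> b < q -> x < q -> y < q -> a != b -> x != y ->
  \sum_(p : 'S_n.+1) (`[< pred_below p x >] && `[< pred_below p y >] : nat) =
  \sum_(p : 'S_n.+1) (`[< pred_below p a >] && `[< pred_below p b >] : nat).
Proof.
move=> aq bq xq yq ab xy; have [t [tx ty tP]] := two_transitive_perm ab xy.
rewrite (sum_perm_mulr t); apply: eq_bigr => p _.
have tl l : q <= l -> forall i : 'I_n.+1, (t i < l) = (i < l).
  move=> ql; apply: (tP (fun i : 'I_n.+1 => i < l));
    by rewrite !(leq_trans _ ql).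
by rewrite (pred_below_perm _ tx) // (pred_below_perm _ ty).
Qed.

(** Cauchy-Schwarz for the number [f p] of positions [x < q] with [pred_below p x]. In the second
    moment the [q] diagonal terms are bounded trivially, and all other pairs behave like [ord0] and
    [o]. *)
Lemma sum_pred_below_sqr (o : 'I_n.+1) : o = 1 :> nat ->
  q * (\sum_(p : 'S_n.+1) (`[< pred_below p ord0 >] : nat)) ^ 2 <=
  (n.+1)`! * ((n.+1)`! + q * \sum_(p : 'S_n.+1)
    (`[< pred_below p ord0 >] && `[< pred_below p o >] : nat)).
Proof.
move=> o1; set S := \sum_p _; set E2 := (X in _ * (_ + _ * X)).
have cq : #|init n.+1 q| = q by rewrite card_init (minn_idPl q_small).
pose f (p : 'S_n.+1) := \sum_(x in init _ q) (`[< pred_below p x >] : nat).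
have sumf : \sum_p f p = q * S.
  rewrite exchange_big /= -{2}cq -sum_nat_const; apply: eq_bigr => x.
  by rewrite inE => xq; apply: sum_pred_below.
have sumf2 : \sum_p f p ^ 2 <= q * ((n.+1)`! + q * E2).
  rewrite (eq_bigr (fun p : 'S_n.+1 => \sum_(x in init _ q) \sum_(y in init _ q)
      (`[< pred_below p x >] && `[< pred_below p y >] : nat))); last first.
    move=> p _; rewrite -mulnn big_distrl /=; apply: eq_bigr => x _.
    by rewrite big_distrr /=; apply: eq_bigr => y _; rewrite mulnb.
  rewrite exchange_big /= -{3}cq -sum_nat_const; apply: leq_sum => x.
  rewrite inE => xq; rewrite exchange_big /= (bigD1 x) /=; last by rewrite inE.
  apply: leq_add.
    rewrite -card_perm_ord -sum1_card; apply: leq_sum => p _; exact: leq_b1.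
  rewrite -{2}cq -sum_nat_const [leqRHS](bigD1 x) /=; last by rewrite inE.
  rewrite -[leqLHS]add0n leq_add //; apply: leq_sum => y; rewrite inE => /andP[yq yx].
  rewrite (@sum_pred_below2 ord0 o) //; last by rewrite eq_sym.
  - by rewrite /=; lia.
  - by rewrite o1.
  - by rewrite -val_eqE /= o1.
have := sum_sqr_leq f; rewrite sumf card_perm_ord => h.
have {h} := leq_trans h (leq_mul (leqnn _) sumf2).
rewrite expnMn -mulnn -mulnA [X in _ <= X]mulnCA leq_pmul2l //; lia.
Qed.

(* For positions [a] and [b] of two elements not yet on the chain: both can be  *)
(* added to chain members to give sets of [F] lying below a set of [F] obtained  *)
(* by adding both to a later chain member.                                       *)
Definition joined p (a b : 'I_n.+1) : Prop :=
  exists l k g, [/\ l <= g, k <= g, p @^-1: (a |: init _ l) \in F,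
    p @^-1: (b |: init _ k) \in F & p @^-1: (a |: (b |: init _ g)) \in F].

Lemma joined_sym p a b : joined p a b -> joined p b a.
Proof. by move=> [l [k [g [? ? ? ?]]]]; rewrite setUCA => ?; exists k, l, g. Qed.

(** Rotate positions: 0 and 1 become the last two and all others move down by two. Removing one
    early element then amounts to adding the other, now late, to a shorter chain member. *)
Lemma sum_pred_below_joined (o a b : 'I_n.+1) :
  o = 1 :> nat -> a = n.-1 :> nat -> b = n :> nat ->
  \sum_(p : 'S_n.+1) (`[< pred_below p ord0 >] && `[< pred_below p o >] : nat) <=
  \sum_(p : 'S_n.+1) (`[< joined p a b >] : nat).
Proof.
move=> o1 an bn.
have [r rE] : exists r : 'S_n.+1, forall i : 'I_n.+1,
    r i = (if i == 0 :> nat then n.-1 else if i == 1 :> nat then n else i.-2) :> nat.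
  pose r := lift_perm ord0 (ord_max : 'I_n.+1) 1; exists (r * r)%g => i.
  have r1 (j : 'I_n.+1) : r j = (if j == 0 :> nat then n else j.-1) :> nat.
    by rewrite /r lift_perm0E -val_eqE /= -ltnS ltn_ord.
  rewrite permM !r1; have n0 : 0 < n by lia.
  by case: (i : nat) => [|[|j]] //=; rewrite ?(gtn_eqF n0).
rewrite [leqRHS](sum_perm_mulr r); apply: leq_sum => p _.
case: asboolP => // -[l0 [g0 [lg0 h0 hg0]]]; case: asboolP => // -[l1 [g1 [lg1 h1 hg1]]].
have ql0 := window_init h0 (subD1set _ _); have ql1 := window_init h1 (subD1set _ _).
have gn0 := init_window hg0 (subxx _); have gn1 := init_window hg1 (subxx _).
have [g [lg0' lg1' hg gn]] : exists g, [/\ l0 <= g, l1 <= g,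
    p @^-1: init _ g \in F & g <= n.+1 - q].
  case: (leqP g0 g1) => gg; [exists g1 | exists g0]; split => //; lia.
(* Removing [o] keeps position 0, which becomes [a]; hence [l1] goes with [a]. All levels are at
   least [q >= 2], so subtracting two does not truncate. *)
case: asboolP => // -[]; exists l1.-2, l0.-2, g.-2; rewrite !pullM.
have E1 : r @^-1: (a |: init _ l1.-2) = init _ l1 :\ o.
  apply/setP => i; rewrite !inE -!val_eqE /= rE an o1; have := ltn_ord i.
  case: (i : nat) => [|[|j]] /=; lia.
have E0 : r @^-1: (b |: init _ l0.-2) = init _ l0 :\ ord0.
  apply/setP => i; rewrite !inE -!val_eqE /= rE bn; have := ltn_ord i.
  case: (i : nat) => [|[|j]] /=; lia.
have Eg : r @^-1: (a |: (b |: init _ g.-2)) = init _ g.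
  apply/setP => i; rewrite !inE -!val_eqE /= rE an bn; have := ltn_ord i.
  case: (i : nat) => [|[|j]] /=; lia.
by rewrite E1 E0 Eg; split => //; lia.
Qed.

(** * The graph of joined pairs on the last positions *)

Section Ends.
Variable w : nat.
Hypothesis w_le_q : w <= q.

(** As [w <= q], chain members occurring in [joined] avoid these positions, which stand for elements
    outside the chain and are exchangeable. *)
Definition ends : {set 'I_n.+1} := [set i : 'I_n.+1 | n.+1 - w <= i].

Lemma card_ends : #|ends| = w.
Proof.
have -> : ends = ~: init _ (n.+1 - w) by apply/setP => i; rewrite !inE -leqNgt.
by rewrite cardsCs setCK card_ord card_init; lia.
Qed.

Lemma joined_perm p t a b x y : t a = x -> t b = y ->
  (forall l, l <= n.+1 - w -> forall i, (t i < l) = (i < l)) ->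
  `[< joined (p * t)%g x y >] = `[< joined p a b >].
Proof.
move=> tax tby tl.
have Eg l : l <= n.+1 - w -> t @^-1: init _ l = init _ l.
  by move=> ln; apply/setP => i; rewrite !inE tl.
have Ea : t @^-1: [set x] = [set a] by apply/setP => i; rewrite !inE -tax (inj_eq perm_inj).
have Eb : t @^-1: [set y] = [set b] by apply/setP => i; rewrite !inE -tby (inj_eq perm_inj).
apply: asbool_equiv_eq; split=> -[l [k [g [lg kg hl hk hg]]]]; exists l, k, g.
  have gn : g <= n.+1 - w.
    by have := init_window hg (subset_trans (subsetUr _ _) (subsetUr _ _)); lia.
  move: hl hk hg; rewrite !pullM !preimsetU Ea Eb !Eg; try lia.
  by rewrite -!preimsetU; split.
have gn : g <= n.+1 - w.
  by have := init_window hg (subset_trans (subsetUr _ _) (subsetUr _ _)); lia.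
move: hl hk hg; rewrite !pullM ![t @^-1: _]preimsetU ![t @^-1: (_ :|: _)]preimsetU Ea Eb !Eg; try lia.
by split.
Qed.

Lemma sum_joined (a b x y : 'I_n.+1) :
  a \in ends -> b \in ends -> x \in ends -> y \in ends -> a != b -> x != y ->
  \sum_(p : 'S_n.+1) (`[< joined p x y >] : nat) =
  \sum_(p : 'S_n.+1) (`[< joined p a b >] : nat).
Proof.
rewrite !inE => aw bw xw yw ab xy; have [t [tx ty tP]] := two_transitive_perm ab xy.
rewrite (sum_perm_mulr t); apply: eq_bigr => p _; congr nat_of_bool.
apply: joined_perm => // l ln; apply: (tP (fun i : 'I_n.+1 => i < l)); lia.
Qed.

Definition joined_rel p : rel 'I_n.+1 := [rel a b | (a != b) && `[< joined p a b >]].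

Lemma joined_rel_sym p : symmetric (joined_rel p).
Proof.
move=> a b; rewrite /joined_rel /= eq_sym; congr (_ && _).
by apply: asbool_equiv_eq; split; apply: joined_sym.
Qed.

Lemma joined_rel_irr p : irreflexive (joined_rel p).
Proof. by move=> a; rewrite /joined_rel /= eqxx. Qed.

Lemma sum_joined_edges (a b : 'I_n.+1) : a \in ends -> b \in ends -> a != b ->
  w * w.-1 * \sum_(p : 'S_n.+1) (`[< joined p a b >] : nat) <=
  \sum_(p : 'S_n.+1) edges (joined_rel p) ends.
Proof.
move=> aE bE ab; set E2 := \sum_p _.
rewrite (eq_bigr (fun p : 'S_n.+1 => \sum_(x in ends) \sum_(y in ends :\ x)
    (`[< joined p x y >] : nat))); last first.
  move=> p _; apply: eq_bigr => x _; rewrite -sum1_card big_mkcond [RHS]big_mkcond /=.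
  apply: eq_bigr => y _; rewrite in_setD1 in_set /joined_rel /= [x == y]eq_sym.
  by case: (y == x); case: (y \in ends); case: `[< _ >].
rewrite exchange_big /= -mulnA -{1}card_ends -sum_nat_const.
apply: leq_sum => x xE; rewrite exchange_big /=.
have -> : w.-1 = #|ends :\ x| by rewrite -card_ends (cardsD1 x) xE.
rewrite -sum_nat_const; apply: leq_sum => y; rewrite in_setD1 => /andP[yx yE].
by rewrite /E2 (@sum_joined a b x y) // eq_sym.
Qed.

(** Vertices of the cycle give the bottoms, its edges the tops. The chain members used avoid the
    cycle, so a bottom meets it in one vertex and a top in the two ends of an edge; this tells the
    sets apart. *)
Lemma crown_of_joined_cycle p c : 2 < size c ->
  path.cycle (joined_rel p) c -> uniq c -> {subset c <= ends} ->
  poset_contains (family_poset F) (crown (size c)).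
Proof.
move=> c3 cyc uc cE; set s := size c in c3 *.
pose x (i : 'I_s) := nth ord0 c i.
have xE (i : 'I_s) : n.+1 - w <= x i by have := cE _ (mem_nth ord0 (ltn_ord i)); rewrite inE.
have x_inj : injective x.
  by move=> i j /eqP; rewrite /x nth_uniq // => /eqP/val_inj.
have xj (i : 'I_s) : joined p (x i) (x (ordS i)).
  by have := @cycle_nth _ _ ord0 c i cyc; rewrite /joined_rel /= => /andP[_ /asboolP].
(* The two joins at [x i] may use different levels; the least possible one lies below both tops. *)
have /fin_all_exists[l lP] (i : 'I_s) : exists l, p @^-1: (x i |: init _ l) \in F /\
    forall k, p @^-1: (x i |: init _ k) \in F -> l <= k.
  have ex : exists l, p @^-1: (x i |: init _ l) \in F.
    by have [l [_ [_ [_ _ h _ _]]]] := xj i; exists l.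
  by case: (ex_minnP ex) => l h1 h2; exists l.
have /fin_all_exists[g gP] (i : 'I_s) : exists g, [/\ l i <= g, l (ordS i) <= g &
    p @^-1: (x i |: (x (ordS i) |: init _ g)) \in F].
  have [l1 [l2 [g [lg1 lg2 h1 h2 h3]]]] := xj i; exists g; split => //.
    by apply: leq_trans lg1; apply: (lP _).2.
  by apply: leq_trans lg2; apply: (lP _).2.
have lx (i j : 'I_s) : (x i < l j) = false.
  have := init_window (lP j).1 (subsetUr _ _); have := xE i; lia.
have gx (i j : 'I_s) : (x i < g j) = false.
  have [_ _ h] := gP j.
  have := init_window h (subset_trans (subsetUr _ _) (subsetUr _ _)); have := xE i; lia.
have ordSE (i : 'I_s) : ordS i = (if i.+1 == s then 0 else i.+1) :> nat.
  rewrite /=; have := ltn_ord i; rewrite leq_eqVlt; case: eqP => [->|_ /= lt].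
    by rewrite modnn.
  by rewrite modn_small.
have inA i j : (x i \in x j |: init _ (l j)) = (i == j).
  by rewrite !inE lx orbF (inj_eq x_inj).
have inB i j : (x i \in x j |: (x (ordS j) |: init _ (g j))) = (i == j) || (i == ordS j).
  by rewrite !inE gx orbF !(inj_eq x_inj).
apply: (@crown_of_sets _ _ _ (fun i => p @^-1: (x i |: init _ (l i)))
  (fun i => p @^-1: (x i |: (x (ordS i) |: init _ (g i))))).
- by move=> i; apply: (lP i).1.
- by move=> i; have [] := gP i.
- by move=> i j /pull_inj/setP/(_ (x i)); rewrite !inA eqxx => /esym/eqP.
- move=> i j /pull_inj/setP E; have := E (x i); have := E (x (ordS i)).
  rewrite !inB !eqxx orbT /= => /esym/orP e1 /esym/orP[/eqP//|/eqP e2].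
  case: e1 => /eqP e1; last by apply: (can_inj (@ordSK _)).
  (* Here the edges at [i] and [j] coincide in opposite directions, which would need a cycle of
     length two. *)
  have := ordSE i; have := ordSE j; rewrite e1 -e2.
  have := ltn_ord i; have := ltn_ord j.
  by case: eqP; case: eqP; lia.
- move=> i j /pull_inj/setP E; have := E (x j); have := E (x (ordS j)).
  rewrite !inB !inA !eqxx orbT /= => /eqP e1 /eqP e2.
  have := ordSE j; rewrite e1 e2; have := ltn_ord i; case: eqP; lia.
- move=> i; apply: preimsetS; apply: setUS; apply: subset_trans (subsetUr _ _).
  have [h _ _] := gP i; apply/subsetP => t; rewrite !inE => lt; exact: leq_trans lt h.
- move=> i; apply: preimsetS; apply: subset_trans (subsetUr _ _); apply: setUS.
  have [_ h _] := gP i; apply/subsetP => t; rewrite !inE => lt; exact: leq_trans lt h.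
Qed.

End Ends.
End Family.

(** * Asymptotics *)

Lemma poset_freeS d (H : porderType d) n (F' F : {set {set 'I_n}}) :
  F' \subset F -> poset_free H F -> poset_free H F'.
Proof.
move=> FF free [f [finj fmono]]; apply: free.
pose g (u : H) : family_poset F := exist (fun A => A \in F) _ (subsetP FF _ (valP (f u))).
exists g; split=> [u v /(congr1 val)/= /val_inj/finj //|u v /fmono].
by rewrite /Order.le.
Qed.

(** For each of the [q] levels [k < q], [(n - q) * 'C(n, k) <= (n - k) * 'C(n, k) = k.+1 * 'C(n,
    k.+1)], at most [q] times the middle binomial. *)
Lemma card_small_sets n q : 2 * q <= n ->
  (n - q) * #|[set A : {set 'I_n} | #|A| < q]| <= q ^ 2 * 'C(n, n %/ 2).
Proof.
move=> qn; apply: (@leq_trans ((n - q) * \sum_(k < q) 'C(n, k))).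
  rewrite leq_mul2l -sum_bool_card; apply/orP; right.
  rewrite (eq_bigr (fun k : 'I_q => \sum_(A : {set 'I_n}) (#|A| == k : nat))); last first.
    by move=> k _; rewrite sum_bool_card card_draws card_ord.
  rewrite exchange_big /=; apply: leq_sum => A _; case: ltnP => // Aq.
  by rewrite (bigD1 (Ordinal Aq)) //= eqxx.
apply: (@leq_trans (\sum_(k < q) q * 'C(n, n %/ 2))); last first.
  by rewrite sum_nat_const card_ord mulnA mulnn.
rewrite big_distrr /=; apply: leq_sum => k _.
apply: (@leq_trans (k.+1 * 'C(n, k.+1))); last first.
  by apply: leq_mul; [exact: ltn_ord|exact: leq_bin_half].
by rewrite mul_bin_left leq_mul2r; apply/orP; right; have := ltn_ord k; lia.
Qed.

Lemma card_large_sets n q : 2 * q <= n ->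
  (n - q) * #|[set A : {set 'I_n} | n - q < #|A|]| <= q ^ 2 * 'C(n, n %/ 2).
Proof.
move=> qn; apply: leq_trans (card_small_sets qn).
rewrite leq_mul2l -(card_imset _ (can_inj (@setCK _))).
apply/orP; right; apply: subset_leq_card; apply/subsetP => _ /imsetP[A + ->].
rewrite !inE (_ : #|~: A| = n - #|A|); last by rewrite [LHS]cardsCs setCK card_ord.
by have := max_card A; rewrite card_ord; lia.
Qed.

Definition window n q : {set {set 'I_n}} :=
  [set A : {set 'I_n} | q <= #|A| <= n - q].

Lemma card_outside_window n q (F : {set {set 'I_n}}) : 2 * q <= n ->
  (n - q) * #|F| <= (n - q) * #|F :&: window n q| + 2 * q ^ 2 * 'C(n, n %/ 2).
Proof.
move=> qn; have := card_small_sets qn; have := card_large_sets qn.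
set S := [set A : {set 'I_n} | #|A| < q]; set L := [set A : {set 'I_n} | n - q < #|A|].
have : #|F| <= #|F :&: window n q| + (#|S| + #|L|).
  apply: leq_trans (leq_add (leqnn _) (leq_card_setU S L)).
  apply: leq_trans (leq_card_setU _ _); apply: subset_leq_card; apply/subsetP => A AF.
  by rewrite !inE AF /=; case: (leqP q #|A|); case: (leqP #|A| (n - q)).
set a := #|F|; set b := #|_ :&: _|; set C := 'C(_, _); nia.
Qed.

Lemma leq_bin_La n m : 0 < m -> 'C(n, n %/ 2) <= La n (crown m).
Proof.
case: m => // m _; pose F := [set A : {set 'I_n} | #|A| == n %/ 2].
have <- : #|F| = 'C(n, n %/ 2) by rewrite card_draws card_ord.
apply: (leq_bigmax_cond F); apply/asboolP => -[f [finj fmono]].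
have := valP (f (inl ord0)); have := valP (f (inr ord0)).
have : val (f (inl ord0)) \subset val (f (inr ord0)) by apply: (fmono (inl ord0) (inr ord0)).
rewrite !inE => sub /eqP c1 /eqP c2.
have /val_inj/finj// : val (f (inl ord0)) = val (f (inr ord0)).
by apply/eqP; rewrite eqEcard sub c1 c2 leqnn.
Qed.

Lemma La_attained n m : 0 < m -> exists2 F : {set {set 'I_n}},
  poset_free (crown m) F & La n (crown m) = #|F|.
Proof.
case: m => // m _; pose P := [pred F : {set {set 'I_n}} | `[< poset_free (crown m.+1) F >]].
have P0 : 0 < #|P|.
  apply/card_gt0P; exists set0; rewrite inE; apply/asboolP => -[f _].
  by have := valP (f (inl ord0)); rewrite inE.
have [F FP E] := eq_bigmax_cond (fun F : {set {set 'I_n}} => #|F|) P0.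
by exists F => //; apply/asboolP; move: FP; rewrite inE.
Qed.

(* Summed over all maximal chains: [X] counts members of [F], [Y] those that   *)
(* are neither first nor last on their chain, [S] dominates the number of       *)
(* chains with two members, and [E] is its second-moment analogue.              *)
Lemma chain_statistics n m q w K (F : {set {set 'I_n.+1}}) :
  (forall A, A \in F -> q <= #|A| <= n.+1 - q) ->
  poset_free (crown m) F -> 2 < m -> 1 < w -> w <= q -> q <= n.+1 ->
  (forall (V : finType) (e : rel V) (U : {set V}), symmetric e -> irreflexive e ->
    #|U| = w -> K < edges e U ->
    exists c, [/\ path.cycle e c, uniq c, size c = m & {subset c <= U}]) ->
  exists X Y S E, [/\ #|F| * (n.+1)`! <= 'C(n.+1, n.+1 %/ 2) * X,
    X <= (n.+1)`! + S + Y /\ q * Y <= m * X,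
    q * S ^ 2 <= (n.+1)`! * ((n.+1)`! + q * E),
    w * w.-1 * E <= (n.+1)`! * K & S <= (n.+1)`! /\ E <= (n.+1)`!].
Proof.
move=> Fw free m3 w2 wq qn turan.
have q1 : 1 < q by exact: leq_trans wq.
have o1 : (inord 1 : 'I_n.+1) = 1 :> nat by rewrite inordK //; lia.
have an : (inord n.-1 : 'I_n.+1) = n.-1 :> nat by rewrite inordK //; lia.
have sumN (P : 'S_n.+1 -> bool) : \sum_(p : 'S_n.+1) (P p : nat) <= (n.+1)`!.
  by rewrite -card_perm_ord -sum1_card; apply: leq_sum => p _; exact: leq_b1.
exists (\sum_(p : 'S_n.+1) chain_count F p).
exists (\sum_(p : 'S_n.+1) \sum_(l < n.+2)
  ((p @^-1: init _ l \in F) && `[< interior_level F p l >] : nat)).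
exists (\sum_(p : 'S_n.+1) (`[< pred_below F p ord0 >] : nat)).
exists (\sum_(p : 'S_n.+1)
  (`[< pred_below F p ord0 >] && `[< pred_below F p (inord 1) >] : nat)).
split; [exact: lubell| |exact: (sum_pred_below_sqr Fw)| |by split; apply: sumN].
  split; last exact: (sum_interior_le Fw).
  apply: (@leq_trans ((n.+1)`! + \sum_(p : 'S_n.+1) (`[< two_on_chain F p >] : nat) +
      \sum_(p : 'S_n.+1) \sum_(l < n.+2)
        ((p @^-1: init _ l \in F) && `[< interior_level F p l >] : nat))).
    rewrite -card_perm_ord -sum1_card -!big_split /=.
    by apply: leq_sum => p _; apply: chain_count_le.
  by rewrite leq_add2r leq_add2l (sum_two_on_chain_le Fw).
have aE : (inord n.-1 : 'I_n.+1) \in ends n w by rewrite inE an; lia.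
have bE : (ord_max : 'I_n.+1) \in ends n w by rewrite inE /=; lia.
have ab : (inord n.-1 : 'I_n.+1) != ord_max by rewrite -val_eqE /= an; lia.
apply: leq_trans (leq_trans (sum_joined_edges Fw q1 qn wq aE bE ab) _).
  by rewrite leq_mul2l (sum_pred_below_joined Fw) ?orbT.
rewrite -card_perm_ord -sum_nat_const; apply: leq_sum => p _.
rewrite leqNgt; apply/negP => /turan[||| c [cyc uc sc cU]].
- exact: joined_rel_sym.
- exact: joined_rel_irr.
- exact: (card_ends q1 qn wq).
by apply: free; rewrite -sc; apply: (crown_of_joined_cycle Fw _ _ wq) cyc uc cU; rewrite ?sc.
Qed.

(* Real densities and limits *)
From mathcomp Require Import all_algebra.
From mathcomp Require Import ring lra.
From mathcomp Require Import all_classical all_reals all_analysis.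

Import Order.TTheory GRing.Theory Num.Theory.
Import numFieldNormedType.Exports.

Local Open Scope ring_scope.

(** The chain statistics divided by the number of chains. The loss from [w - 1] against [w] and the
    term [1 / q] are absorbed by [ep ^+ 2], giving [s <= s0 + ep]. *)
Lemma second_moment_bound (R : realFieldType) (q w m x s y e2 s0 ep : R) :
  0 <= s0 -> 0 < ep <= 1 -> 0 < q -> 0 < w -> w <= q -> 4 <= ep ^+ 2 * w -> 4 * m <= ep * q ->
  0 <= x -> s <= 1 -> e2 <= 1 ->
  x <= 1 + s + y -> q * y <= m * x -> q * s ^+ 2 <= 1 + q * e2 ->
  w * (w - 1) * e2 <= (s0 ^+ 2 + ep ^+ 2 / 4) * w ^+ 2 ->
  x <= 1 + s0 + 2 * ep.
Proof.
move=> s00 /andP[ep0 ep1] q0 w0 wq hw hm x0 s1 e21 hx hy hs he.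
have e2le : e2 <= s0 ^+ 2 + ep ^+ 2 / 2.
  have : w * (w * e2) <= w * (w * (s0 ^+ 2 + ep ^+ 2 / 4) + 1) by nra.
  rewrite ler_pM2l // => h.
  have : w * e2 <= w * (s0 ^+ 2 + ep ^+ 2 / 2) by nra.
  by rewrite ler_pM2l.
have s2le : s ^+ 2 <= (s0 + ep) ^+ 2.
  have : q * s ^+ 2 <= q * (ep ^+ 2 / 4 + e2) by nra.
  rewrite ler_pM2l // => h.
  have : 0 <= s0 * ep by apply: mulr_ge0 => //; exact: ltW.
  nra.
have sle : s <= s0 + ep.
  rewrite leNgt; apply/negP => lt; have : 0 <= s0 + ep by lra.
  nra.
have yle : 4 * y <= ep * x.
  have : q * (4 * y) <= q * (ep * x) by nra.
  by rewrite ler_pM2l.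
(* With [s <= 1] this gives [x <= 8 / 3], hence [y <= ep * x / 4 <= ep]. *)
have : ep * x <= x by nra.
nra.
Qed.

Lemma windowed_crown_free_bound (R : realType) n m q w (F : {set {set 'I_n.+1}})
    (s0 ep : R) :
  (forall A, A \in F -> (q <= #|A| <= n.+1 - q)%N) ->
  poset_free (crown m) F -> (2 < m)%N -> (1 < w)%N -> (w <= q)%N -> (q <= n.+1)%N ->
  0 <= s0 -> 0 < ep <= 1 -> 4 <= ep ^+ 2 * w%:R -> 4 * m%:R <= ep * q%:R ->
  (forall (V : finType) (e : rel V) (U : {set V}), symmetric e -> irreflexive e ->
    #|U| = w -> (s0 ^+ 2 + ep ^+ 2 / 4) * w%:R ^+ 2 < (edges e U)%:R ->
    exists c, [/\ path.cycle e c, uniq c, size c = m & {subset c <= U}]) ->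
  #|F|%:R <= (1 + s0 + 2 * ep) * 'C(n.+1, n.+1 %/ 2)%:R.
Proof.
move=> Fw free m3 w2 wq qn s00 ep01 hw hm turan.
pose bd : R := (s0 ^+ 2 + ep ^+ 2 / 4) * w%:R ^+ 2.
have bd0 : 0 <= bd.
  by rewrite mulr_ge0 ?exprn_ge0 ?addr_ge0 ?divr_ge0 ?exprn_ge0 ?ler0n //; lra.
have [|X [Y [S [E [h1 [h2 h3] h4 h5 [h6 h7]]]]]] :=
  @chain_statistics n m q w (Num.truncn bd) F Fw free m3 w2 wq qn.
  move=> V e U se ie Uw lt; apply: (turan V e U) => //.
  by rewrite ltNge -truncn_ge_nat // -ltnNge.
pose Nf : R := (n.+1)`!%:R.
have Nf0 : 0 < Nf by rewrite ltr0n fact_gt0.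
have [q0 w0] : 0 < q%:R :> R /\ 0 < w%:R :> R by rewrite !ltr0n; split; lia.
have xle : X%:R / Nf <= 1 + s0 + 2 * ep.
  apply: (@second_moment_bound R q%:R w%:R m%:R _ (S%:R / Nf) (Y%:R / Nf) (E%:R / Nf)) => //.
  - by rewrite ler_nat.
  - by rewrite divr_ge0 ?ler0n.
  - by rewrite ler_pdivrMr // mul1r ler_nat.
  - by rewrite ler_pdivrMr // mul1r ler_nat.
  - have -> : 1 + S%:R / Nf + Y%:R / Nf = (Nf + S%:R + Y%:R) / Nf by field; rewrite gt_eqF.
    by rewrite ler_pM2r ?invr_gt0 // -!natrD ler_nat.
  - by rewrite !mulrA ler_pM2r ?invr_gt0 // -!natrM ler_nat.
  - have -> : 1 + q%:R * (E%:R / Nf) = Nf * (Nf + q%:R * E%:R) / Nf ^+ 2 by field; rewrite gt_eqF.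
    rewrite expr_div_n mulrA ler_pM2r ?invr_gt0 ?exprn_gt0 //.
    by rewrite -natrX -!natrM -natrD -natrM ler_nat.
  - rewrite mulrA ler_pdivrMr // mulrC; apply: (@le_trans _ _ (Nf * (Num.truncn bd)%:R)).
      have -> : w%:R - 1 = w.-1%:R :> R by rewrite -[in LHS](@prednK w) ?(ltnW w2) // -natr1 addrK.
      by rewrite mulrC -!natrM ler_nat.
    by rewrite mulrC ler_pM2r // truncn_le.
have : #|F|%:R * Nf <= 'C(n.+1, n.+1 %/ 2)%:R * X%:R by rewrite -!natrM ler_nat.
rewrite -ler_pdivlMr // => h; apply: le_trans h _.
by rewrite -mulrA mulrC ler_wpM2r ?ler0n.
Qed.

(** [s0 ^+ 2] is a density above which [m]-cycles are forced. Constants are chosen in order: [d]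
    from [ep], [w] from the cycle threshold, [q] from [w], then [n] large against [q]. *)
Lemma La_crown_upper (R : realType) m (s0 : R) : (2 < m)%N -> 0 <= s0 ->
  (forall eta : R, 0 < eta -> exists w0, forall (V : finType) (e : rel V) (U : {set V}),
    symmetric e -> irreflexive e -> (w0 <= #|U|)%N ->
    (s0 ^+ 2 + eta) * #|U|%:R ^+ 2 < (edges e U)%:R ->
    exists c, [/\ path.cycle e c, uniq c, size c = m & {subset c <= U}]) ->
  forall ep : R, 0 < ep -> exists N, forall n, (N <= n)%N ->
    (La n (crown m))%:R <= (1 + s0 + ep) * 'C(n, n %/ 2)%:R.
Proof.
move=> m3 s00 turan ep ep0.
(* Half of [ep] pays for the error [2 * d], the other half for the sets outside the window. *)
pose d : R := Num.min 1 (ep / 4).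
have d0 : 0 < d by rewrite lt_min ltr01 divr_gt0.
have [d1 dep] : d <= 1 /\ d <= ep / 4 by split; rewrite /d ge_min lexx ?orbT.
have [w0 hw0] := turan (d ^+ 2 / 4) (divr_gt0 (exprn_gt0 2 d0) (ltr0Sn _ _)).
have bound (x : R) : exists k, x <= k%:R.
  exists (Num.bound `|x|).
  exact: le_trans (ler_norm x) (ltW (archi_boundP (normr_ge0 x))).
have [w1 hw1] := bound (4 / d ^+ 2); have [q1 hq1] := bound (4 * m%:R / d).
pose w := (w0 + w1 + 2)%N; pose q := (w + q1)%N.
have [N1 hN1] := bound (2 * q%:R ^+ 2 / (ep / 2)).
exists (N1 + 2 * q + 1)%N => -[|n] Nn; first by lia.
have [F free ->] := @La_attained n.+1 m ltac:(lia).
have qn : (2 * q <= n.+1)%N by lia.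
have := card_outside_window F qn.
set F' := F :&: _; set C := 'C(_, _) => hF.
have hF' : #|F'|%:R <= (1 + s0 + 2 * d) * C%:R.
  apply: (@windowed_crown_free_bound R n m q w) => //.
  - by move=> A; rewrite !inE => /andP[].
  - by apply: poset_freeS free; apply: subsetIl.
  - by rewrite /w; lia.
  - by rewrite /q; lia.
  - by lia.
  - by rewrite d0.
  - move: hw1; rewrite ler_pdivrMr ?exprn_gt0 // mulrC => h; apply: le_trans h _.
    by rewrite ler_wpM2l ?exprn_ge0 ?(ltW d0) // ler_nat /w; lia.
  - move: hq1; rewrite ler_pdivrMr // [q1%:R * _]mulrC => h; apply: le_trans h _.
    by rewrite ler_wpM2l ?(ltW d0) // ler_nat /q; lia.
  - move=> V e U se ie Uw lt; apply: hw0 => //; first by rewrite Uw /w; lia.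
    by rewrite Uw.
have nq : 2 * q%:R ^+ 2 <= ep / 2 * (n.+1 - q)%N%:R.
  move: hN1; rewrite ler_pdivrMr ?divr_gt0 // [N1%:R * _]mulrC => h; apply: le_trans h _.
  by rewrite ler_wpM2l ?divr_ge0 ?(ltW ep0) // ler_nat; lia.
have nq0 : 0 < (n.+1 - q)%N%:R :> R by rewrite ltr0n; lia.
rewrite -(ler_pM2l nq0); apply: (@le_trans _ _ ((n.+1 - q)%N%:R * #|F'|%:R + 2 * q%:R ^+ 2 * C%:R)).
  by rewrite -natrX -!natrM -natrD ler_nat.
have C0 : 0 <= C%:R :> R by rewrite ler0n.
apply: (@le_trans _ _ ((n.+1 - q)%N%:R * ((1 + s0 + 2 * d) * C%:R) +
    ep / 2 * (n.+1 - q)%N%:R * C%:R)).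
  by apply: lerD; [rewrite ler_pM2l|rewrite ler_wpM2r].
rewrite [ep / 2 * _]mulrC -mulrA -mulrDr ler_pM2l // -mulrDl ler_wpM2r //; lra.
Qed.

(** Any positive density forces an even cycle; [0 ^+ 2] matches [La_crown_upper] with [s0 = 0]. *)
Lemma even_cycle_turan (R : realType) k (eta : R) : (0 < k)%N -> 0 < eta ->
  exists w0, forall (V : finType) (e : rel V) (U : {set V}),
    symmetric e -> irreflexive e -> (w0 <= #|U|)%N ->
    (0 ^+ 2 + eta) * #|U|%:R ^+ 2 < (edges e U)%:R ->
    exists c, [/\ path.cycle e c, uniq c, size c = (2 * k)%N & {subset c <= U}].
Proof.
move=> k0 eta0; pose D := (Num.bound (2 / eta)).+1.
have hD : 2 <= D%:R * eta.
  rewrite -ler_pdivrMr //; apply: ltW.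
  apply: lt_le_trans (archi_boundP (divr_ge0 (ler0n _ 2) (ltW eta0))) _.
  by rewrite ler_nat /D.
exists (3 * (2 * k * D) * 2 ^ (2 * k * D) + D * (2 * k * D)).+1%N => V e U se ie Uw.
rewrite expr0n add0r => lt; rewrite mul2n; apply: (dense_even_cycle se (D := D)) => //.
rewrite -(ler_nat R) natrM natrX natrM.
apply: (@le_trans _ _ (D%:R * (eta * #|U|%:R ^+ 2))).
  by rewrite mulrA ler_wpM2r ?exprn_ge0.
by rewrite ler_wpM2l // ltW.
Qed.

(** With [D >= 3 / eta], the density [1 / 2 + 3 / D] required by [dense_odd_cycle] is at most
    [1 / 2 + eta]. *)
Lemma odd_cycle_turan (R : realType) r (s0 eta : R) : (0 < r)%N -> 0 < eta ->
  s0 ^+ 2 = 1 / 2 ->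
  exists w0, forall (V : finType) (e : rel V) (U : {set V}),
    symmetric e -> irreflexive e -> (w0 <= #|U|)%N ->
    (s0 ^+ 2 + eta) * #|U|%:R ^+ 2 < (edges e U)%:R ->
    exists c, [/\ path.cycle e c, uniq c, size c = r.*2.+1 & {subset c <= U}].
Proof.
move=> r0 eta0 ->; pose D := (Num.bound (3 / eta)).+1.
have hD : 3 <= D%:R * eta.
  rewrite -ler_pdivrMr //; apply: ltW.
  apply: lt_le_trans (archi_boundP (divr_ge0 (ler0n _ 3) (ltW eta0))) _.
  by rewrite ler_nat /D.
exists (2 * D * (D * r.*2.+1) + D + 2).+1%N => V e U se ie Uw lt.
apply: (dense_odd_cycle se ie (D := D)) => //.
rewrite -(ler_nat R) natrM natrX natrD -mul2n !natrM.
apply: (@le_trans _ _ (2 * D%:R * ((1 / 2 + eta) * #|U|%:R ^+ 2))).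
  rewrite mulrA ler_wpM2r ?exprn_ge0 //.
  have -> : 2 * D%:R * (1 / 2 + eta) = D%:R + 2 * (D%:R * eta) by field.
  by lra.
by rewrite ler_wpM2l ?mulr_ge0 // ltW.
Qed.

Local Open Scope classical_set_scope.

Theorem theorem3 (R : realType) (k : nat) (hk : (2 <= k)%N) :
  (exists eps : nat -> R,
     (eps n @[n --> \oo] --> (0 : R)) /\
     forall n : nat,
       (La n (crown (2 * k)))%:R = (1 + eps n) * 'C(n, n %/ 2)%:R) /\
  (exists eps : nat -> R,
     (eps n @[n --> \oo] --> (0 : R)) /\
     forall n : nat,
       (La n (crown (2 * k - 1)))%:R
         <= (1 + Num.sqrt 2 / 2 + eps n) * 'C(n, n %/ 2)%:R).
Proof.
have C0 n : 0 < 'C(n, n %/ 2)%:R :> R by rewrite ltr0n bin_gt0; lia.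
split.
  (* The equality forces this error term; the middle layer, an antichain, makes it nonnegative. *)
  exists (fun n => (La n (crown (2 * k)))%:R / 'C(n, n %/ 2)%:R - 1); split; last first.
    by move=> n; field; rewrite gt_eqF.
  have /(_ ltac:(lia) (lexx _)) upper := @La_crown_upper R (2 * k) 0.
  apply/cvgrPdist_le => ep ep0.
  have [|N hN] := upper _ ep ep0.
    by move=> eta; apply: even_cycle_turan; lia.
  exists N => // n /= Nn; rewrite sub0r normrN ger0_norm.
    by rewrite lerBlDr ler_pdivrMr // [ep + 1]addrC; have := hN n Nn; rewrite addr0.
  by rewrite subr_ge0 ler_pdivlMr // mul1r ler_nat leq_bin_La //; lia.
have sq0 : 0 <= Num.sqrt 2 / 2 :> R by rewrite divr_ge0 ?sqrtr_ge0.
have sq2 : (Num.sqrt 2 / 2) ^+ 2 = 1 / 2 :> R.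
  by rewrite expr_div_n sqr_sqrtr //; field.
pose c n : R := (La n (crown (2 * k - 1)))%:R / 'C(n, n %/ 2)%:R - (1 + Num.sqrt 2 / 2).
(* Only an upper bound is claimed, so [c n] might stay below 0; cutting it off at 0 ensures
   convergence. *)
exists (fun n => Num.max 0 (c n)); split; last first.
  move=> n; rewrite -ler_pdivrMr // -lerBlDl.
  by rewrite le_max lexx orbT.
have /(_ ltac:(lia) sq0) upper := @La_crown_upper R (2 * k - 1) (Num.sqrt 2 / 2).
apply/cvgrPdist_le => ep ep0.
have [|N hN] := upper _ ep ep0.
  move=> eta eta0; have -> : (2 * k - 1)%N = k.-1.*2.+1 by lia.
  by apply: odd_cycle_turan => //; lia.
exists N => // n /= Nn; rewrite sub0r normrN ger0_norm; last by rewrite le_max lexx.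
rewrite ge_max ltW //= /c lerBlDl ler_pdivrMr //.
exact: hN.
Qed.
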